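(* Let $\mathfrak{g}$ be a finite-dimensional nilpotent real Lie algebra, let $I:\mathfrak{g}\to\mathfrak{g}$ be an $\mathbb{R}$-linear map with $I^2=-\mathrm{Id}$, let $\mathfrak{g}_{\mathbb{C}}:=\mathfrak{g}\otimes_{\mathbb{R}}\mathbb{C}$, and let $\mathfrak{g}_{\mathbb{C}}=\mathfrak{g}^{1,0}\oplus\mathfrak{g}^{0,1}$ be the decomposition into the eigenspaces of $I$ for the eigenvalues $\sqrt{-1}$ and $-\sqrt{-1}$ respectively. Assume that $\mathfrak{g}^{1,0}\subset\mathfrak{g}_{\mathbb{C}}$ is a complex Lie subalgebra. Let $\theta\in\mathfrak{g}^*$ be a non-zero real 1-form with $d\theta=0$, where $d$ is the Chevalley--Eilenberg differential. Then the cohomology of the complex $(\Lambda^{0,*}(\mathfrak{g}^* ),\bar\partial_\theta)$ vanishes, i.e. for every $q\geq 0$ the kernel of $\bar\partial_\theta:\Lambda^{0,q}(\mathfrak{g}^* )\to\Lambda^{0,q+1}(\mathfrak{g}^* )$ equals the image of $\bar\partial_\theta:\Lambda^{0,q-1}(\mathfrak{g}^* )\to\Lambda^{0,q}(\mathfrak{g}^* )$ (with $\Lambda^{0,-1}(\mathfrak{g}^* ):=0$).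
   Context: The Chevalley--Eilenberg differential $d$ on $\Lambda^*(\mathfrak{g}^* )$ is the degree-one derivation given on 1-forms by $d\lambda(x,y)=-\lambda([x,y])$; it is extended complex-linearly to $\Lambda^*(\mathfrak{g}_{\mathbb{C}}^* )$. The Hodge decomposition is $\Lambda^*(\mathfrak{g}_{\mathbb{C}}^* )=\bigoplus_{p,q}\Lambda^{p,q}(\mathfrak{g}^* )$ with $\Lambda^{p,q}(\mathfrak{g}^* )=\Lambda^p((\mathfrak{g}^{1,0})^* )\otimes_{\mathbb{C}}\Lambda^q((\mathfrak{g}^{0,1})^* )$. When $\mathfrak{g}^{1,0}$ is a Lie subalgebra, $d=\partial+\bar\partial$ with $\partial$ of bidegree $(1,0)$ and $\bar\partial$ of bidegree $(0,1)$. For a closed real 1-form $\theta\in\mathfrak{g}^*$, write $\theta=\theta^{1,0}+\theta^{0,1}$ for its Hodge components. The twisted Chevalley--Eilenberg differential is $d_\theta(x):=d(x)-\theta\wedge x$, and the twisted Dolbeault differentials are its Hodge components $\partial_\theta=\partial-\theta^{1,0}\wedge\cdot$ and $\bar\partial_\theta=\bar\partial-\theta^{0,1}\wedge\cdot$, of bidegrees $(1,0)$ and $(0,1)$. *)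

(* Defs.v *)
From HB Require Import structures.
From mathcomp Require Import all_boot all_order all_fingroup all_algebra.
From mathcomp Require Import reals complex ring.
Set Implicit Arguments. Unset Strict Implicit. Unset Printing Implicit Defensive.
Import Order.TTheory GRing.Theory Num.Theory.
Local Open Scope ring_scope.

Section Forms.
Variables (K : numFieldType) (V : lmodType K).

(* A form of degree k is a function of k vectors satisfying [is_form] below;
   equality of forms is pointwise, [=1]. *)
Definition cochain k := {ffun 'I_k -> V} -> K.

Definition upd k (x : {ffun 'I_k -> V}) (i : 'I_k) (v : V) : {ffun 'I_k -> V} :=
  [ffun j => if j == i then v else x j].

Definition pull k l (x : {ffun 'I_l -> V}) (f : 'I_k -> 'I_l) : {ffun 'I_k -> V} :=
  [ffun j => x (f j)].

Definition multilinear k (w : cochain k) :=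
  forall x i (a : K) u v,
    w (upd x i (a *: u + v)) = a * w (upd x i u) + w (upd x i v).

Definition alternating k (w : cochain k) :=
  forall (x : {ffun 'I_k -> V}) (i j : 'I_k), i != j -> x i = x j -> w x = 0.

Definition is_form k (w : cochain k) := multilinear w /\ alternating w.

Definition form1 (l : V -> K) : cochain 1 := fun x => l (x ord0).

Definition wedge k l (a : cochain k) (b : cochain l) : cochain (k + l) :=
  fun x => (k`! * l`!)%:R^-1 *
    \sum_(s : 'S_(k + l)) (-1) ^+ s *
      (a (pull x (s \o lshift l)) * b (pull x (s \o @rshift k l))).

End Forms.

Record is_lie_bracket (K : numFieldType) (V : lmodType K) (br : V -> V -> V) :
    Prop := IsLieBracket {
  lie_linearl : forall y a u v, br (a *: u + v) y = a *: br u y + br v y;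
  lie_linearr : forall x a u v, br x (a *: u + v) = a *: br x u + br x v;
  lie_xx : forall x, br x x = 0;
  lie_jacobi : forall x y z, br x (br y z) + br y (br z x) + br z (br x y) = 0
}.

(* Moving the bracket to the first slot gives the usual expression
   sum_(i < j) (-1)^(i+j) w([x_i, x_j], x_0, .., ^x_i, .., ^x_j, .., x_k);
   here x_i is deleted, and [x_i, x_j] stands in the place of x_j, which has
   index [lift i j] in x and index [j >= i] once x_i is deleted.  By
   [ce_diff_form1] and [ce_diff_wedge] below, this is the degree-one derivation
   with d l (x, y) = - l [x, y]. *)
Definition ce_diff (K : numFieldType) (V : lmodType K) (br : V -> V -> V) k
    (w : cochain V k) : cochain V k.+1 :=
  fun x => \sum_(i < k.+1) \sum_(j < k | (i <= j)%N)
    (-1) ^+ i.+1 * w (upd (pull x (lift i)) j (br (x i) (x (lift i j)))).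

Section Nilpotent.
Variables (K : numFieldType) (V : vectType K) (br : V -> V -> V).

Definition lie_prod (U W : {vspace V}) : {vspace V} :=
  <<[seq br u w | u <- vbasis U, w <- vbasis W]>>%VS.

Fixpoint lower_central n : {vspace V} :=
  if n is n'.+1 then lie_prod fullv (lower_central n') else fullv.

Definition nilpotent_lie := exists n, lower_central n = 0%VS.

End Nilpotent.

Section Complexification.
Variables (R : realType) (g : vectType R).

(* (x, y) stands for x + sqrt(-1) y in the tensor product of g with R[i]. *)
Definition cplx : Type := (g * g)%type.
HB.instance Definition _ := GRing.Zmodule.copy cplx (g * g)%type.

Definition cplx_scale (c : R[i]) (z : cplx) : cplx :=
  (complex.Re c *: z.1 - complex.Im c *: z.2,
   complex.Re c *: z.2 + complex.Im c *: z.1).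


Fact cplx_scaleA a b v : cplx_scale a (cplx_scale b v) = cplx_scale (a * b) v.
Proof.
case: a b v => [a a'] [b b'] [x y]; rewrite /cplx_scale /=.
rewrite !(scalerBr, scalerDr) !scalerA !(scalerBl, scalerDl).
congr (_, _); first by rewrite !opprD [- (_ *: y) - _]addrC addrACA.
by rewrite [_ *: x - _]addrC addrACA.
Qed.

Fact cplx_scale1 : left_id 1 cplx_scale.
Proof.
by case=> x y; rewrite /cplx_scale /= !scale1r !scale0r subr0 addr0.
Qed.

Fact cplx_scaleDr : right_distributive cplx_scale +%R.
Proof.
move=> [a a'] [x y] [z t]; rewrite /cplx_scale /=; congr (_, _) => /=.
  by rewrite !scalerDr opprD addrACA.
by rewrite !scalerDr addrACA.
Qed.

Fact cplx_scaleDl v : {morph cplx_scale^~ v : a b / a + b}.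
Proof.
move=> [a a'] [b b']; case: v => x y; rewrite /cplx_scale /=; congr (_, _) => /=.
  by rewrite !scalerDl opprD addrACA.
by rewrite !scalerDl addrACA.
Qed.

HB.instance Definition _ := GRing.Zmodule_isLmodule.Build R[i] cplx
  cplx_scaleA cplx_scale1 cplx_scaleDr cplx_scaleDl.

Definition cplx_bracket (br : g -> g -> g) (z w : cplx) : cplx :=
  (br z.1 w.1 - br z.2 w.2, br z.1 w.2 + br z.2 w.1).

Definition cplx_map (f : g -> g) (z : cplx) : cplx := (f z.1, f z.2).

Definition cplx_covector (l : g -> R) (z : cplx) : R[i] :=
  Complex (l z.1) (l z.2).

Variable I : g -> g.

Definition g10 : {pred cplx} := [pred z | cplx_map I z == 'i%C *: z].
Definition g01 : {pred cplx} := [pred z | cplx_map I z == - 'i%C *: z].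

Definition pr10 (z : cplx) : cplx := 2%:R^-1 *: (z - 'i%C *: cplx_map I z).
Definition pr01 (z : cplx) : cplx := 2%:R^-1 *: (z + 'i%C *: cplx_map I z).

(* The dual of g10 sits in the dual of the complexification as the covectors
   that vanish on g01; likewise its exterior powers, and likewise for g01. *)
Definition form10 p (a : cochain cplx p) :=
  is_form a /\ forall (x : {ffun 'I_p -> cplx}) i, x i \in g01 -> a x = 0.
Definition form01 q (b : cochain cplx q) :=
  is_form b /\ forall (x : {ffun 'I_q -> cplx}) i, x i \in g10 -> b x = 0.

Definition hodge_form p q (w : cochain cplx (p + q)) :=
  exists n (a : 'I_n -> cochain cplx p) (b : 'I_n -> cochain cplx q),
    [/\ forall i, form10 (a i), forall i, form01 (b i)
      & w =1 fun x => \sum_(i < n) wedge (a i) (b i) x].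

(* Component of bidegree (p, k - p) of a form of degree k; see
   [hodge_comp_sum] and [hodge_compP] below. *)
Definition hodge_comp p k (w : cochain cplx k) : cochain cplx k :=
  fun x => \sum_(S : {set 'I_k} | #|S| == p)
    w [ffun i => if i \in S then pr10 (x i) else pr01 (x i)].

Variable br : g -> g -> g.

Definition dolbeault_bar k (w : cochain cplx k) : cochain cplx k.+1 :=
  fun x => \sum_(p < k.+1)
    hodge_comp p (ce_diff (cplx_bracket br) (hodge_comp p w)) x.

Variable theta : g -> R.

Definition theta01 : cochain cplx 1 :=
  hodge_comp 0 (form1 (cplx_covector theta)).

Definition twisted_dolbeault_bar k (w : cochain cplx k) : cochain cplx k.+1 :=
  fun x => dolbeault_bar w x - wedge theta01 w x.

Definition twisted_dolbeault_kernel q (w : cochain cplx q) :=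
  hodge_form (p := 0) w /\ twisted_dolbeault_bar w =1 fun=> 0.

Definition twisted_dolbeault_image q : cochain cplx q -> Prop :=
  if q is q'.+1 then
    fun w => exists2 eta : cochain cplx q', hodge_form (p := 0) eta
                                      & w =1 twisted_dolbeault_bar eta
  else fun w => w =1 fun=> 0.

End Complexification.

Section Calculus.
Variables (K : numFieldType) (V : lmodType K).

Definition vcons k (y : V) (z : {ffun 'I_k -> V}) : {ffun 'I_k.+1 -> V} :=
  [ffun i => if unlift ord0 i is Some j then z j else y].

Definition contr k (y : V) (w : cochain V k.+1) : cochain V k :=
  fun z => w (vcons y z).

Lemma vcons0 k y (z : {ffun 'I_k -> V}) : vcons y z ord0 = y.
Proof. by rewrite ffunE unlift_none. Qed.

Lemma vconsS k y (z : {ffun 'I_k -> V}) j : vcons y z (lift ord0 j) = z j.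
Proof. by rewrite ffunE liftK. Qed.

Lemma vconsP k (x : {ffun 'I_k.+1 -> V}) :
  x = vcons (x ord0) (pull x (lift ord0)).
Proof.
by apply/ffunP=> i; rewrite ffunE; case: unliftP => [j|] ->; rewrite ?ffunE.
Qed.

Lemma upd_cons0 k y u (z : {ffun 'I_k -> V}) : upd (vcons y z) ord0 u = vcons u z.
Proof.
apply/ffunP=> i; rewrite !ffunE; case: unliftP => [j|] ->; rewrite ?eqxx //.
Qed.

Lemma upd_consS k y u (z : {ffun 'I_k -> V}) j :
  upd (vcons y z) (lift ord0 j) u = vcons y (upd z j u).
Proof.
apply/ffunP=> i; rewrite !ffunE; case: unliftP => [i'|] -> //.
by rewrite !ffunE (inj_eq lift_inj).
Qed.

Lemma upd_same k (x : {ffun 'I_k -> V}) i : upd x i (x i) = x.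
Proof. by apply/ffunP=> j; rewrite ffunE; case: eqP => [->|]. Qed.

Lemma upd_upd k (x : {ffun 'I_k -> V}) i u v : upd (upd x i u) i v = upd x i v.
Proof. by apply/ffunP=> j; rewrite !ffunE; case: eqP. Qed.

Lemma upd_comm k (x : {ffun 'I_k -> V}) i j u v : i != j ->
  upd (upd x i u) j v = upd (upd x j v) i u.
Proof.
move=> ij; apply/ffunP=> m; rewrite !ffunE.
by case: (eqVneq m j) => // ->; rewrite eq_sym (negbTE ij).
Qed.

Lemma eq_pull k l (x : {ffun 'I_l -> V}) (f h : 'I_k -> 'I_l) :
  f =1 h -> pull x f = pull x h.
Proof. by move=> fh; apply/ffunP=> i; rewrite !ffunE fh. Qed.

Lemma pull_pull k l m (x : {ffun 'I_m -> V}) (h : 'I_l -> 'I_m) (f : 'I_k -> 'I_l) :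
  pull (pull x h) f = pull x (h \o f).
Proof. by apply/ffunP=> i; rewrite !ffunE. Qed.

Lemma pull_id k (x : {ffun 'I_k -> V}) f : f =1 id -> pull x f = x.
Proof. by move=> fE; apply/ffunP=> i; rewrite ffunE fE. Qed.

Section Alternation.
Variables (k : nat) (w : cochain V k).
Hypothesis wF : is_form w.

Lemma form_updD x i u v : w (upd x i (u + v)) = w (upd x i u) + w (upd x i v).
Proof. by have := wF.1 x i 1 u v; rewrite scale1r mul1r. Qed.

Lemma form_upd0 x i : w (upd x i 0) = 0.
Proof.
have := form_updD x i 0 0; rewrite addr0 => /eqP.
by rewrite -subr_eq subrr eq_sym => /eqP.
Qed.

Lemma form_swap_upd x i j u v : i != j ->
  w (upd (upd x i u) j v) = - w (upd (upd x i v) j u).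
Proof.
move=> ij.
have alt0 t : w (upd (upd x i t) j t) = 0.
  by apply: (wF.2 _ _ _ ij); rewrite !ffunE eqxx (negbTE ij) eqxx.
have := alt0 (u + v); rewrite form_updD upd_comm // (upd_comm _ (u + v)) //.
rewrite !form_updD -!(upd_comm _ _ _ ij) !alt0 add0r addr0 addrC.
by move/eqP; rewrite addr_eq0 => /eqP.
Qed.

Lemma form_tperm x i j : i != j -> w (pull x (tperm i j)) = - w x.
Proof.
move=> ij; have {2}-> : x = upd (upd x i (x i)) j (x j) by rewrite !upd_same.
rewrite form_swap_upd // opprK; congr (w _); apply/ffunP=> m; rewrite !ffunE.
case: tpermP => [->|->|/eqP/negbTE mi /eqP/negbTE mj]; rewrite ?eqxx ?(negbTE ij) //.
by rewrite mi mj.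
Qed.

Lemma form_perm x (s : 'S_k) : w (pull x s) = (-1) ^+ s * w x.
Proof.
have [ts -> _] := prod_tpermP s.
elim: ts x => [|t ts IH] x.
  by rewrite big_nil odd_perm1 expr0 mul1r pull_id // => i; rewrite perm1.
have [t12|t12] := eqVneq t.1 t.2.
  rewrite big_cons t12 tperm1 mul1g; exact: IH.
rewrite big_cons odd_mul_tperm t12 signr_addb expr1 mulN1r mulNr -IH.
rewrite -(form_tperm _ t12); congr (w _); apply/ffunP=> i; rewrite !ffunE.
by rewrite permM.
Qed.

End Alternation.

Lemma form_perm_cast k n (w : cochain V k) (e : k = n) x (s : 'S_n) : is_form w ->
  w (pull x (s \o cast_ord e)) = (-1) ^+ s * w (pull x (cast_ord e)).
Proof.
subst n => wF; rewrite -form_perm // pull_pull; congr (w _); apply: eq_pull => i /=.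
by rewrite !cast_ord_id.
Qed.

Lemma form_insert k (w : cochain V k.+1) (x : {ffun 'I_k.+1 -> V}) (m : 'I_k.+1) :
  is_form w -> w x = (-1) ^+ m * w (vcons (x m) (pull x (lift m))).
Proof.
move=> wF; have := form_perm wF (vcons (x m) (pull x (lift m))) (lift_perm m ord0 1).
rewrite odd_lift_perm odd_perm1 addbF addbF signr_odd => <-; congr (w _).
apply/ffunP=> i; rewrite !ffunE; case: (unliftP m i) => [j|] ->.
  by rewrite lift_perm_lift perm1 liftK ffunE.
by rewrite lift_perm_id unlift_none.
Qed.

Lemma sum_lift_perm n (A : zmodType) (F : 'S_n.+1 -> A) :
  \sum_s F s = \sum_m \sum_(t : 'S_n) F (lift_perm m ord0 t).
Proof.
rewrite (partition_big (fun s : 'S_n.+1 => s^-1%g ord0) xpredT) //=.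
apply: eq_bigr => m _.
rewrite (eq_bigl (fun s : 'S_n.+1 => s m == ord0)); last first.
  by move=> s; rewrite -(inj_eq (@perm_inj _ s)) permKV eq_sym.
rewrite (reindex (lift_perm m ord0)); last first.
  pose ulsf i (s : 'S_n.+1) k := odflt k (unlift (s i) (s (lift i k))).
  have ulsfK i (s : 'S_n.+1) k: lift (s i) (ulsf i s k) = s (lift i k).
    rewrite /ulsf; have:= neq_lift i k.
    by rewrite -(can_eq (permK s)) => /unlift_some[] ? ? ->.
  have inj_ulsf: injective (ulsf m _).
    move=> s; apply: can_inj (ulsf (s m) s^-1%g) _ => k'.
    by rewrite {1}/ulsf ulsfK !permK liftK.
  exists (fun s => perm (inj_ulsf s)) => [s _ | s].
    by apply/permP=> k'; rewrite permE /ulsf lift_perm_lift lift_perm_id liftK.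
  move/(s _ =P _) => si0; apply/permP=> k.
  case: (unliftP m k) => [k'|] ->; rewrite ?lift_perm_id //.
  by rewrite lift_perm_lift -si0 permE ulsfK.
by apply: eq_bigl => t; rewrite lift_perm_id eqxx.
Qed.


Lemma wedge_cast k l n (a : cochain V k) (b : cochain V l) (e : (k + l)%N = n)
    (x : {ffun 'I_n -> V}) :
  wedge a b (pull x (cast_ord e)) = (k`! * l`!)%:R^-1 *
    \sum_(s : 'S_n) (-1) ^+ s * (a (pull x (s \o cast_ord e \o lshift l)) *
                                 b (pull x (s \o cast_ord e \o @rshift k l))).
Proof.
subst n; rewrite /wedge; congr (_ * _); apply: eq_bigr => s _.
congr (_ * (_ * _)); [congr (a _)|congr (b _)];
  by rewrite pull_pull; apply: eq_pull => i /=; rewrite !cast_ord_id.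
Qed.

Lemma contr_wedge k l (a : cochain V k.+1) (b : cochain V l.+1) y
    (e : (k.+1 + l)%N = (k + l.+1)%N) (z : {ffun 'I_(k + l.+1) -> V}) :
  is_form a -> is_form b ->
  contr y (wedge a b) z =
    wedge (contr y a) b z +
    (-1) ^+ k.+1 * wedge a (contr y b) (pull z (cast_ord e)).
Proof.
move=> aF bF; rewrite wedge_cast.
have sgn_mul (m : nat) (s : bool) (A : K) :
    (-1) ^+ (odd m (+) false (+) s) * ((-1) ^+ m * A) = (-1) ^+ s * A.
  by rewrite addbF signr_addb signr_odd mulrACA -expr2 sqrr_sign mul1r.
rewrite {1}/contr {1}/wedge sum_lift_perm.
rewrite (@big_split_ord _ _ _ k.+1 l.+1 xpredT) /= mulrDr; congr (_ + _).
  rewrite /wedge.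
  transitivity ((k.+1`! * l.+1`!)%:R^-1 * \sum_(m < k.+1)
     \sum_(s : 'S_(k + l.+1)) (-1) ^+ s * (contr y a (pull z (s \o lshift l.+1)) *
       b (pull z (s \o @rshift k l.+1)))); last first.
    rewrite sumr_const card_ord -[X in _ * X]mulr_natl mulrA; congr (_ * _).
    by rewrite factS -mulnA natrM invfM mulrAC mulVf ?mul1r // pnatr_eq0.
  congr (_ * _); apply: eq_bigr => m _; apply: eq_bigr => s _.
  rewrite (form_insert _ m aF) odd_lift_perm -mulrA sgn_mul //.
  have liftl p : lift (lshift l.+1 m) (lshift l.+1 p) = lshift l.+1 (lift m p).
    exact: val_inj.
  have liftr q : lift (lshift l.+1 m) (@rshift k l.+1 q) = @rshift k.+1 l.+1 q.
    by apply: val_inj; rewrite /= /bump (leq_trans (n := k)) ?leq_addr // -ltnS.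
  congr (_ * (_ * _)).
    rewrite /contr; congr (a (vcons _ _)).
      by rewrite ffunE /= lift_perm_id vcons0.
    by apply/ffunP=> p; rewrite !ffunE /= -liftl lift_perm_lift liftK.
  congr (b _); apply/ffunP=> q.
  by rewrite !ffunE /= -liftr lift_perm_lift liftK.
transitivity ((k.+1`! * l.+1`!)%:R^-1 * \sum_(m < l.+1)
   \sum_(s : 'S_(k + l.+1)) (-1) ^+ k.+1 * ((-1) ^+ s *
     (a (pull z (s \o cast_ord e \o lshift l)) *
      contr y b (pull z (s \o cast_ord e \o @rshift k.+1 l)))));
  last first.
  rewrite sumr_const card_ord -[X in _ * X]mulr_natl mulrA -mulr_sumr mulrCA.
  congr (_ * (_ * _)).
  by rewrite factS mulnCA natrM invfM mulrAC mulVf ?mul1r // pnatr_eq0.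
congr (_ * _); apply: eq_bigr => m _; apply: eq_bigr => s _.
rewrite (form_insert _ m bF) odd_lift_perm.
have -> : odd (rshift k.+1 m) = odd k.+1 (+) odd m by rewrite oddD.
have liftl p : lift (rshift k.+1 m) (cast_ord e (lshift l p)) = lshift l.+1 p.
  by apply: val_inj; rewrite /= /bump leqNgt ltn_addr //= ltn_ord.
have liftr q : lift (rshift k.+1 m) (cast_ord e (@rshift k.+1 l q)) =
               rshift k.+1 (lift m q).
  by apply: val_inj; rewrite /= /bump -[(k.+1 + q)%N]/(k.+1 + q)%N leq_add2l addnCA.
rewrite -addbA -addbA signr_addb signr_odd -mulrA [a _ * _]mulrCA addbA sgn_mul //.
congr (_ * (_ * (_ * _))).
  congr (a _); apply/ffunP=> p.
  by rewrite !ffunE /= -liftl lift_perm_lift liftK.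
rewrite /contr; congr (b (vcons _ _)).
  by rewrite ffunE /= lift_perm_id vcons0.
by apply/ffunP=> q; rewrite !ffunE /= -liftr lift_perm_lift liftK.
Qed.

Lemma contr_form k (w : cochain V k.+1) y : is_form w -> is_form (contr y w).
Proof.
move=> wF; split=> [x i a u v|x i j ij xij].
  by rewrite /contr -!upd_consS wF.1.
apply: (wF.2 _ (lift ord0 i) (lift ord0 j)); rewrite ?(inj_eq lift_inj) //.
by rewrite !vconsS.
Qed.

Lemma alternating_cons k (w : cochain V k.+2) : multilinear w ->
  (forall y, alternating (contr y w)) ->
  (forall y z, w (vcons y (vcons y z)) = 0) -> alternating w.
Proof.
move=> wL w_alt w_eq.
have updD x i u v : w (upd x i (u + v)) = w (upd x i u) + w (upd x i v).
  by have := wL x i 1 u v; rewrite scale1r mul1r.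
have swap u v z : w (vcons u (vcons v z)) = - w (vcons v (vcons u z)).
  have := w_eq (u + v) z; rewrite -(upd_cons0 0 (u + v)) updD !upd_cons0.
  rewrite -(upd_cons0 0 (u + v) z) -!upd_consS !updD !upd_consS !upd_cons0 !w_eq.
  by rewrite add0r addr0 => /eqP; rewrite addr_eq0 => /eqP.
have alt_lt (x : {ffun 'I_k.+2 -> V}) (i j : 'I_k.+2) : (i < j)%N -> x i = x j -> w x = 0.
  case: (unliftP ord0 i) => [i'|] -> ; case: (unliftP ord0 j) => [j'|] -> // ij xij.
    rewrite (vconsP x); apply: (w_alt _ _ i' j').
      by apply: contraTneq ij => ->; rewrite ltnn.
    by rewrite !ffunE.
  case: (unliftP ord0 j') xij => [j''|] -> xij; last first.
    by rewrite (vconsP x) (vconsP (pull x _)) ffunE -xij.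
  rewrite (vconsP x) (vconsP (pull x _)) swap.
  apply/eqP; rewrite oppr_eq0; apply/eqP.
  apply: (w_alt _ _ ord0 (lift ord0 j'')) => //.
  by rewrite vcons0 vconsS !ffunE.
move=> x i j ij xij; case: (ltngtP i j) => [lt_ij|lt_ji|/val_inj/eqP].
- exact: alt_lt lt_ij xij.
- exact: alt_lt lt_ji (esym xij).
- by rewrite (negbTE ij).
Qed.

Lemma eq_wedge k l (a a' : cochain V k) (b b' : cochain V l) :
  a =1 a' -> b =1 b' -> wedge a b =1 wedge a' b'.
Proof.
move=> aE bE x; rewrite /wedge; congr (_ * _); apply: eq_bigr => s _.
by rewrite aE bE.
Qed.

Lemma wedgeDl k l (a a' : cochain V k) (b : cochain V l) c x :
  wedge (fun y => a y + c * a' y) b x = wedge a b x + c * wedge a' b x.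
Proof.
rewrite /wedge mulrCA -mulrDr; congr (_ * _).
rewrite mulr_sumr -big_split /=; apply: eq_bigr => s _.
by rewrite mulrDl mulrDr -(mulrA c) (mulrCA _ c).
Qed.

Lemma wedgeDr k l (a : cochain V k) (b b' : cochain V l) c x :
  wedge a (fun y => b y + c * b' y) x = wedge a b x + c * wedge a b' x.
Proof.
rewrite /wedge mulrCA -mulrDr; congr (_ * _).
rewrite mulr_sumr -big_split /=; apply: eq_bigr => s _.
by rewrite !mulrDr (mulrCA _ c) (mulrCA _ c).
Qed.

Lemma wedge_0l l (a : cochain V 0) (b : cochain V l) x : is_form b ->
  wedge a b x = a [ffun=> 0] * b x.
Proof.
move=> bF; rewrite /wedge (eq_bigr (fun=> a [ffun=> 0] * b x)) => [|s _].
  rewrite sumr_const card_Sn -[X in _ * X]mulr_natl !mulrA fact0 mul1n.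
  rewrite -[(0 + l)`!]/(l`!) mulVf ?mul1r //.
  by rewrite pnatr_eq0 -lt0n fact_gt0.
have -> : pull x (s \o lshift l) = [ffun=> 0] by apply/ffunP=> - [].
rewrite mulrCA; congr (_ * _).
rewrite (_ : pull x _ = pull x s) ?form_perm ?mulrA -?expr2 ?sqrr_sign ?mul1r //.
by apply: eq_pull => i /=; congr (s _); apply: val_inj.
Qed.

Lemma wedge_0r k (a : cochain V k) (b : cochain V 0) (e : k = (k + 0)%N) x :
  is_form a -> wedge a b x = a (pull x (cast_ord e)) * b [ffun=> 0].
Proof.
move=> aF; rewrite /wedge
  (eq_bigr (fun=> a (pull x (cast_ord e)) * b [ffun=> 0])) => [|s _].
  rewrite sumr_const card_Sn -[X in _ * X]mulr_natl !mulrA fact0 muln1.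
  have -> : (k + 0)`! = k`! by rewrite addn0.
  by rewrite mulVf ?mul1r // pnatr_eq0 -lt0n fact_gt0.
have -> : pull x (s \o @rshift k 0) = [ffun=> 0] by apply/ffunP=> - [].
rewrite mulrA; congr (_ * _).
rewrite (_ : pull x _ = pull x (s \o cast_ord e)).
  by rewrite form_perm_cast // mulrA -expr2 sqrr_sign mul1r.
by apply: eq_pull => i /=; congr (s _); apply: val_inj.
Qed.

Section Lie.
Variable br : V -> V -> V.
Hypothesis br_lie : is_lie_bracket br.

Definition lie_deriv k (y : V) (w : cochain V k) : cochain V k :=
  fun z => - \sum_(j < k) w (upd z j (br y (z j))).

Lemma ce_diff0 (w : cochain V 0) x : ce_diff br w x = 0.
Proof. by rewrite /ce_diff big1 // => i _; rewrite big1 // => - []. Qed.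

Lemma ce_diff_form1 (l : V -> K) x :
  ce_diff br (form1 l) x = - l (br (x ord0) (x ord_max)).
Proof.
rewrite /ce_diff big_ord_recl big_ord1 big_mkcond big_ord1 [X in _ + X]big_mkcond.
rewrite big_ord1 /= addr0.
rewrite expr1 mulN1r /form1 ffunE eqxx; congr (- l (br _ (x _))).
exact: val_inj.
Qed.

Lemma cartan k (w : cochain V k.+1) y z :
  contr y (ce_diff br w) z = lie_deriv y w z - ce_diff br (contr y w) z.
Proof.
rewrite /contr /ce_diff big_ord_recl; congr (_ + _).
  rewrite /lie_deriv -sumrN; apply: eq_bigr => j _.
  rewrite expr1 mulN1r vcons0 vconsS; congr (- w (upd _ _ _)).
  by apply/ffunP=> i; rewrite ffunE vconsS.
rewrite -sumrN; apply: eq_bigr => i _.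
rewrite big_mkcond big_ord_recl /= add0r -sumrN [RHS]big_mkcond.
apply: eq_bigr => j _; rewrite /bump !add1n ltnS; case: ifP => // ij.
rewrite [_ ^+ (i.+2)]exprS mulN1r mulNr; congr (- (_ * _)).
have lift2 m : lift (lift ord0 i) (lift ord0 m) = lift ord0 (lift i m).
  by apply: val_inj; rewrite /= /bump !add1n ltnS addnS.
have -> : pull (vcons y z) (lift (lift ord0 i)) = vcons y (pull z (lift i)).
  apply/ffunP=> m; rewrite [LHS]ffunE; case: (unliftP ord0 m) => [m'|] ->.
    by rewrite lift2 !vconsS ffunE.
  by rewrite vcons0 [X in vcons y z X](_ : _ = ord0) ?vcons0 //; apply: val_inj.
by rewrite lift2 !vconsS upd_consS.
Qed.

Lemma eq_ce_diff k (w w' : cochain V k) : w =1 w' -> ce_diff br w =1 ce_diff br w'.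
Proof.
move=> wE x; rewrite /ce_diff; apply: eq_bigr => i _; apply: eq_bigr => j _.
by rewrite wE.
Qed.

Lemma ce_diffD k (w w' : cochain V k) c x :
  ce_diff br (fun y => w y + c * w' y) x = ce_diff br w x + c * ce_diff br w' x.
Proof.
rewrite /ce_diff mulr_sumr -big_split /=; apply: eq_bigr => i _.
rewrite mulr_sumr -big_split /=; apply: eq_bigr => j _.
by rewrite mulrDr (mulrCA c).
Qed.

Lemma ce_diff_cast k n (e : k = n) (e' : k.+1 = n.+1) (w : cochain V k) x :
  ce_diff br (fun y => w (pull y (cast_ord e))) x =
  ce_diff br w (pull x (cast_ord e')).
Proof.
subst n; rewrite [pull x _]pull_id; last by move=> i; apply: val_inj.
apply: eq_ce_diff => y; congr w; apply: pull_id => i; exact: val_inj.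
Qed.

Lemma lie_deriv_form k (w : cochain V k) y : is_form w -> is_form (lie_deriv y w).
Proof.
move=> wF; split=> [x m a u v|x m n mn xmn]; rewrite /lie_deriv.
  rewrite mulrN -opprD mulr_sumr -big_split /=; congr (- _).
  apply: eq_bigr => j _; have [->|jm] := eqVneq j m.
    by rewrite !upd_upd !ffunE eqxx (lie_linearr br_lie) wF.1.
  rewrite !(ffunE, negbTE jm) !(upd_comm _ _ _ (_ : m != j)) 1?eq_sym //.
  exact: wF.1.
rewrite (bigD1 m) // (bigD1 n) 1?eq_sym //= big1 ?addr0 => [|j /andP[jm jn]].
  rewrite -xmn; set u := br y _.
  have -> : upd x m u = upd (upd x m u) n (x m).
    by rewrite upd_comm // xmn upd_same.
  by rewrite form_swap_upd // upd_same addNr oppr0.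
by apply: (wF.2 _ _ _ mn); rewrite !ffunE !(eq_sym _ j) (negbTE jm) (negbTE jn).
Qed.

Lemma ce_diff_multilinear k (w : cochain V k) :
  is_form w -> multilinear (ce_diff br w).
Proof.
elim: k w => [|k IH] w wF x i a u v; first by rewrite !ce_diff0 mulr0 addr0.
rewrite (vconsP x); move: (x ord0) (pull _ _) => y z {x}.
case: (unliftP ord0 i) => [m|] ->.
  rewrite !upd_consS -![ce_diff br w (vcons _ _)]/(contr y (ce_diff br w) _).
  rewrite !cartan (lie_deriv_form y wF).1 (IH _ (contr_form y wF)).
  by rewrite mulrBr opprD addrACA.
rewrite !upd_cons0 -![ce_diff br w (vcons _ _)]/(contr _ (ce_diff br w) _).
rewrite !cartan.
rewrite (@eq_ce_diff _ (contr (a *: u + v) w) (fun t => contr v w t + a * contr u w t)).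
  rewrite ce_diffD mulrBr [RHS]addrACA -[in RHS]opprD (addrC (ce_diff _ _ _)).
  congr (_ - _).
  rewrite /lie_deriv mulrN -opprD mulr_sumr -big_split /=; congr (- _).
  by apply: eq_bigr => j _; rewrite (lie_linearl br_lie) wF.1.
move=> t; rewrite /contr -(upd_cons0 0) wF.1 !upd_cons0; exact: addrC.
Qed.

Lemma ce_diff_form k (w : cochain V k) : is_form w -> is_form (ce_diff br w).
Proof.
move=> wF; split; first exact: ce_diff_multilinear.
elim: k w wF => [|k IH] w wF; first by move=> x i j; rewrite !ord1.
apply: alternating_cons; first exact: ce_diff_multilinear.
  move=> y x i j ij xij; rewrite cartan ((lie_deriv_form y wF).2 _ _ _ ij xij).
  by rewrite (IH _ (contr_form y wF) _ _ _ ij xij) subr0.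
move=> y z; rewrite -[LHS]/(contr y (ce_diff br w) _) cartan.
have -> : lie_deriv y w (vcons y z) = lie_deriv y (contr y w) z.
  rewrite /lie_deriv big_ord_recl vcons0 (lie_xx br_lie) (form_upd0 wF) add0r.
  by congr (- _); apply: eq_bigr => j _; rewrite vconsS upd_consS.
case: k {IH} w wF z => [|k] w wF z.
  by rewrite ce_diff0 subr0 /lie_deriv big_ord0 oppr0.
rewrite -[ce_diff _ _ _]/(contr y (ce_diff br (contr y w)) _) cartan.
rewrite opprB addrC subrK /ce_diff big1 // => i _; rewrite big1 // => j _.
rewrite /contr (wF.2 _ ord0 (lift ord0 ord0)) ?mulr0 //.
by rewrite vconsS !vcons0.
Qed.

Lemma pull_upd_perm n k (z : {ffun 'I_n -> V}) (f : 'I_k -> 'I_n) (i : 'I_k) u :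
  injective f -> pull (upd z (f i) u) f = upd (pull z f) i u.
Proof.
by move=> f_inj; apply/ffunP=> j; rewrite !ffunE (inj_eq f_inj).
Qed.

Lemma pull_upd_out n k (z : {ffun 'I_n -> V}) (f : 'I_k -> 'I_n) (j : 'I_n) u :
  (forall i, f i != j) -> pull (upd z j u) f = pull z f.
Proof. by move=> fj; apply/ffunP=> i; rewrite !ffunE (negbTE (fj i)). Qed.

Lemma lie_deriv_wedge k l (a : cochain V k) (b : cochain V l) y z :
  lie_deriv y (wedge a b) z = wedge (lie_deriv y a) b z + wedge a (lie_deriv y b) z.
Proof.
rewrite /lie_deriv /wedge -mulr_sumr -mulrN -mulrDr; congr (_ * _).
rewrite exchange_big /= -sumrN -big_split /=; apply: eq_bigr => s _.
rewrite -mulr_sumr -mulrN -mulrDr; congr (_ * _).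
rewrite (reindex_inj (@perm_inj _ s)) big_split_ord /= opprD mulNr mulrN.
rewrite mulr_suml mulr_sumr; congr (- _ - _); apply: eq_bigr => j _.
  rewrite (pull_upd_perm z (f := s \o lshift l)); last first.
    exact: inj_comp (@perm_inj _ s) (@lshift_inj _ _).
  rewrite [pull _ (s \o @rshift _ _)]pull_upd_out ?ffunE // => i.
  by rewrite (inj_eq (@perm_inj _ s)) /= eq_rlshift.
rewrite (pull_upd_perm z (f := s \o @rshift k l)); last first.
  exact: inj_comp (@perm_inj _ s) (@rshift_inj _ _).
rewrite [pull _ (s \o lshift _)]pull_upd_out ?ffunE // => i.
by rewrite (inj_eq (@perm_inj _ s)) /= eq_lrshift.
Qed.

Lemma ce_diff_wedge k l (a : cochain V k) (b : cochain V l)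
    (e : (k + l.+1)%N = (k + l).+1) x : is_form a -> is_form b ->
  ce_diff br (wedge a b) x =
    wedge (ce_diff br a) b x + (-1) ^+ k * wedge a (ce_diff br b) (pull x (cast_ord e)).
Proof.
have [n] := ubnP (k + l); elim: n => // n IH in k l a b e x *.
case: k a e x => [|k] a e x.
  move=> _ aF bF; rewrite expr0 mul1r.
  rewrite (wedge_0l a (b := ce_diff br b)); last exact: ce_diff_form.
  rewrite (eq_ce_diff (w := wedge a b) 
    (w' := fun y => 0 + a [ffun=> 0] * b y)); last first.
    by move=> y; rewrite add0r wedge_0l.
  rewrite ce_diffD [ce_diff _ (fun=> 0) _]big1 => [|i _]; last first.
    by rewrite big1 // => j _; rewrite mulr0.
  rewrite [wedge _ _ _]mulr_sumr big1 => [|s _]; last by rewrite ce_diff0 mul0r !mulr0.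
  rewrite !add0r; congr (_ * ce_diff br b _).
  by apply/ffunP=> i; rewrite ffunE; congr (x _); apply: val_inj.
case: l b e x => [|l] b e x.
  move=> _ aF bF.
  pose e0 := esym (addn0 k.+1); pose e1 : k.+2 = (k.+2 + 0)%N := esym (addn0 k.+2).
  rewrite (eq_ce_diff (w := wedge a b) 
    (w' := fun y => 0 + b [ffun=> 0] * a (pull y (cast_ord e0)))).
    rewrite ce_diffD [ce_diff _ (fun=> 0) _]big1 => [|i _]; last first.
      by rewrite big1 // => j _; rewrite mulr0.
    rewrite (ce_diff_cast e0 e1) (wedge_0r _ e1); last exact: ce_diff_form.
    have -> : wedge a (ce_diff br b) (pull x (cast_ord e)) = 0.
      by rewrite /wedge big1 ?mulr0 // => s _; rewrite ce_diff0 !mulr0.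
    by rewrite mulr0 addr0 add0r mulrC.
  by move=> y; rewrite add0r (wedge_0r _ e0) // mulrC.
rewrite ltnS => lt_n aF bF.
rewrite (vconsP x); move: (x ord0) (pull _ _) => y z {x}.
have e1 : (k.+1 + l)%N = (k + l.+1)%N by rewrite addnS.
have e2 : (k.+2 + l)%N = (k.+1 + l.+1)%N by rewrite addnS.
have e3 : (k + l.+2)%N = (k + l.+1).+1 by rewrite addnS.
have e4 : (k.+1 + l.+1)%N = (k.+1 + l).+1 by rewrite addnS.
have e5 : (k.+1 + l.+1)%N = (k + l.+2)%N by rewrite !addnS.
have -> : ce_diff br (wedge a b) (vcons y z) =
    lie_deriv y (wedge a b) z - ce_diff br (contr y (wedge a b)) z.
  exact: (@cartan (k + l.+1) (wedge a b) y z).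
rewrite lie_deriv_wedge.
rewrite -[wedge (ce_diff br a) b _]/(contr y (wedge (ce_diff br a) b) z).
have daF := ce_diff_form aF; have dbF := ce_diff_form bF.
rewrite (contr_wedge y e2 z daF bF).
have -> : pull (vcons y z) (cast_ord e) = vcons y (pull z (cast_ord e3)).
  apply/ffunP=> i; rewrite ffunE; case: (unliftP ord0 i) => [j|] ->.
    have -> : cast_ord e (lift ord0 j) = lift ord0 (cast_ord e3 j).
      exact: val_inj.
    by rewrite !vconsS ffunE.
  have -> : cast_ord e ord0 = ord0 by apply: val_inj.
  by rewrite !vcons0.
rewrite -[wedge a (ce_diff br b) _]/
  (contr y (wedge a (ce_diff br b)) (pull z (cast_ord e3))).
rewrite (contr_wedge y e5 (pull z (cast_ord e3)) aF dbF).
rewrite (eq_ce_diff (w := contr y (wedge a b)) 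
  (w' := fun t => wedge (contr y a) b t +
     (-1) ^+ k.+1 * wedge a (contr y b) (pull t (cast_ord e1)))); last first.
  by move=> t; exact: (contr_wedge y e1 t aF bF).
rewrite ce_diffD (ce_diff_cast e1 e2).
rewrite (IH k l.+1 _ _ e3 z lt_n (contr_form y aF) bF).
rewrite (IH k.+1 l _ _ e4 (pull z (cast_ord e2)) _ aF (contr_form y bF)); last first.
  by rewrite addSn -addnS.
have aE : contr y (ce_diff br a) =1
    (fun t => lie_deriv y a t + -1 * ce_diff br (contr y a) t).
  by move=> t; rewrite mulN1r cartan.
have bE : contr y (ce_diff br b) =1
    (fun t => lie_deriv y b t + -1 * ce_diff br (contr y b) t).
  by move=> t; rewrite mulN1r cartan.
rewrite (eq_wedge aE (frefl b)) (eq_wedge (frefl a) bE) wedgeDl wedgeDr.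
rewrite !pull_pull.
rewrite [pull z (_ \o cast_ord e5)]pull_id; last by move=> i; apply: val_inj.
rewrite [pull z (_ \o cast_ord e4)]pull_id; last by move=> i; apply: val_inj.
rewrite !exprS; set s := (-1) ^+ k.
have ss : s * s = 1 by rewrite -expr2 sqrr_sign.
move: (wedge (lie_deriv y a) b z) (wedge a (lie_deriv y b) z) => t1 t2.
move: (wedge (ce_diff br (contr y a)) b z) (wedge a (ce_diff br (contr y b)) z) => t3 t4.
move: (wedge (ce_diff br a) (contr y b) _) (wedge (contr y a) (ce_diff br b) _) => t5 t6.
clearbody s.
ring: ss.
Qed.

End Lie.
End Calculus.

Lemma lie_prodP (K : numFieldType) (V : vectType K) (br : V -> V -> V)
    (br_lie : is_lie_bracket br) (U W X : {vspace V}) :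
  (lie_prod br U W <= X)%VS <->
  forall u w, u \in U -> w \in W -> br u w \in X.
Proof.
split=> [/span_subvP sX u w uU wW | X_br]; last first.
  apply/span_subvP=> _ /allpairsP[[u w] /= [/vbasis_mem uU /vbasis_mem wW ->]].
  exact: X_br.
have br0l y : br 0 y = 0.
  by have := lie_linearl br_lie y (-1) 0 0; rewrite scaler0 addr0 scaleN1r addNr.
have br0r y : br y 0 = 0.
  by have := lie_linearr br_lie y (-1) 0 0; rewrite scaler0 addr0 scaleN1r addNr.
rewrite (coord_vbasis uU) (coord_vbasis wW).
elim/big_rec: _ => [|i u' _ IHu]; first by rewrite br0l mem0v.
rewrite (lie_linearl br_lie) rpredD // rpredZ //.
elim/big_rec: _ => [|j w' _ IHw]; first by rewrite br0r mem0v.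
rewrite (lie_linearr br_lie) rpredD // rpredZ //.
by apply: sX; apply: allpairs_f; apply: mem_nth; rewrite size_tuple.
Qed.

Section Multi.
Variables (K : numFieldType) (V : lmodType K).
Lemma multilinear_expand k (w : cochain V k) (u v : {ffun 'I_k -> V}) :
  multilinear w ->
  w [ffun i => u i + v i] =
    \sum_(S : {set 'I_k}) w [ffun i => if i \in S then u i else v i].
Proof.
move=> wL.
have updD x i t t' : w (upd x i (t + t')) = w (upd x i t) + w (upd x i t').
  by have := wL x i 1 t t'; rewrite scale1r mul1r.
pose F (r : {set 'I_k}) := \sum_(S : {set 'I_k} | S \subset r)
  w [ffun i => if i \in S then u i else if i \in r then v i else u i + v i].
suff F_step (r : {set 'I_k}) j : j \notin r -> F (j |: r) = F r.
  have F_all r : F r = w [ffun i => u i + v i].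
    have [n] := ubnP #|r|; elim: n r => // n IH r.
    have [->|[j jr]] := set_0Vmem r.
      move=> _; rewrite /F (big_pred1 set0) => [|S]; last by rewrite subset0.
      by congr w; apply/ffunP=> i; rewrite !ffunE !inE.
    rewrite -(setD1K jr) ltnS => lt_r; rewrite F_step ?setD11 // IH //.
    by move: lt_r; rewrite cardsU1 setD11 add1n.
  rewrite -(F_all setT); apply: eq_big => S; first by rewrite subsetT.
  by move=> _; congr w; apply/ffunP=> i; rewrite !ffunE inE.
move=> jr; rewrite /F (bigID (fun S : {set 'I_k} => j \in S)) /=.
rewrite (reindex_onto (fun S => j |: S) (fun S => S :\ j)) /=; last first.
  by move=> S /andP[_ jS]; rewrite setD1K.
rewrite (eq_bigl (fun S : {set 'I_k} => S \subset r)) => [|S]; last first.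
  rewrite setU11 andbT; apply/andP/idP => [[sub /eqP SE]|sub].
    by rewrite -SE -(setU1K jr) setSD.
  split; first exact: setUS.
  by rewrite setU1K //; apply: contra jr; apply: (subsetP sub).
rewrite [X in _ + X](eq_bigl (fun S : {set 'I_k} => S \subset r)) => [|S]; last first.
  by rewrite -subsetD1 setU1K.
rewrite -big_split /=; apply: eq_bigr => S sub.
have jS : j \notin S by apply: contra jr; apply: (subsetP sub).
set x := [ffun i => if i \in S then u i else if i \in r then v i else u i + v i].
have -> : x = upd x j (u j + v j).
  by apply/ffunP=> i; rewrite !ffunE; case: eqP => // ->; rewrite (negbTE jS) (negbTE jr).
rewrite updD; congr (w _ + w _); apply/ffunP=> i; rewrite !ffunE !inE.
  by case: eqP => //= ->.
by case: eqP => //= ->; rewrite (negbTE jS).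
Qed.
End Multi.

Section Hodge.
Variables (R : realType) (g : vectType R) (I : {linear g -> g}).
Hypothesis I_sq : forall x, I (I x) = - x.

Lemma cplx_mapZ (c : R[i]) (z : cplx g) : cplx_map I (c *: z) = c *: cplx_map I z.
Proof.
by case: c z => [a b] [x y]; congr (_, _); rewrite /= ?raddfB ?raddfD /= !linearZ.
Qed.

Lemma cplx_mapD (z w : cplx g) : cplx_map I (z + w) = cplx_map I z + cplx_map I w.
Proof. by congr (_, _); rewrite /= raddfD. Qed.

Lemma cplx_map_sq (z : cplx g) : cplx_map I (cplx_map I z) = - z.
Proof. by case: z => x y; rewrite /cplx_map /= !I_sq. Qed.

Lemma icplx_sq : 'i%C * 'i%C = -1 :> R[i].
Proof.
apply/eqP; rewrite eq_complex /= !(mul0r, mulr0, mul1r, sub0r, oppr0, addr0).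
by rewrite !eqxx.
Qed.

Lemma pr10P z : pr10 I z \in g10 I.
Proof.
rewrite inE /pr10 -scaleNr cplx_mapZ cplx_mapD cplx_mapZ cplx_map_sq.
rewrite [X in _ == X]scalerA mulrC -scalerA; apply/eqP; congr (_ *: _).
by rewrite scalerDr scalerA mulrN icplx_sq opprK scale1r scaleNr scalerN opprK addrC.
Qed.

Lemma pr01P z : pr01 I z \in g01 I.
Proof.
rewrite inE /pr01 cplx_mapZ cplx_mapD cplx_mapZ cplx_map_sq.
rewrite [X in _ == X]scalerA mulrC -scalerA; apply/eqP; congr (_ *: _).
by rewrite scalerDr scalerA mulNr icplx_sq opprK scale1r scaleNr scalerN addrC.
Qed.

Lemma pr10D01 z : pr10 I z + pr01 I z = z.
Proof.
rewrite /pr10 /pr01 -scalerDr addrACA addNr addr0 -mulr2n -[z *+ 2]scaler_nat.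
rewrite scalerA mulVf ?scale1r //.
by rewrite pnatr_eq0.
Qed.

Lemma hodge_comp_sum k (w : cochain (cplx g) k) x : multilinear w ->
  \sum_(p < k.+1) hodge_comp I p w x = w x.
Proof.
move=> wL; transitivity (w [ffun i => pr10 I (x i) + pr01 I (x i)]); last first.
  by congr w; apply/ffunP=> i; rewrite ffunE pr10D01.
rewrite -[w _]/(w [ffun i => pr10 I (x i) + pr01 I (x i)]).
have -> : [ffun i => pr10 I (x i) + pr01 I (x i)] =
   [ffun i => [ffun i => pr10 I (x i)] i + [ffun i => pr01 I (x i)] i].
  by apply/ffunP=> i; rewrite !ffunE.
rewrite multilinear_expand //.
rewrite (partition_big (fun S : {set 'I_k} => inord #|S| : 'I_k.+1) xpredT) //=.
apply: eq_bigr => p _; rewrite /hodge_comp; apply: eq_big => [S|S _].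
  by rewrite -val_eqE /= inordK // ltnS -[k in (_ <= k)%N]card_ord max_card.
by congr w; apply/ffunP=> i; rewrite !ffunE.
Qed.

Lemma form10_pr10 p (a : cochain (cplx g) p)
    (x : {ffun 'I_p -> cplx g}) : form10 I a ->
  a [ffun i => pr10 I (x i)] = a x.
Proof.
move=> [aF a01].
have {2}-> : x = [ffun i => [ffun i => pr10 I (x i)] i + [ffun i => pr01 I (x i)] i].
  by apply/ffunP=> i; rewrite !ffunE pr10D01.
rewrite (multilinear_expand _ _ aF.1) (bigD1 setT) //= big1 ?addr0 => [|S].
  by congr a; apply/ffunP=> i; rewrite !ffunE inE.
rewrite -subTset => /subsetPn[i _ iS]; apply: (a01 _ i).
by rewrite !ffunE (negbTE iS) pr01P.
Qed.

Lemma form01_pr01 q (b : cochain (cplx g) q)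
    (x : {ffun 'I_q -> cplx g}) : form01 I b ->
  b [ffun i => pr01 I (x i)] = b x.
Proof.
move=> [bF b10].
have {2}-> : x = [ffun i => [ffun i => pr10 I (x i)] i + [ffun i => pr01 I (x i)] i].
  by apply/ffunP=> i; rewrite !ffunE pr10D01.
rewrite (multilinear_expand _ _ bF.1) (bigD1 set0) //= big1 ?addr0 => [|S].
  by congr b; apply/ffunP=> i; rewrite !ffunE inE.
case/set0Pn=> i iS; apply: (b10 _ i).
by rewrite !ffunE iS pr10P.
Qed.

Lemma hodge_comp_wedge p q p' (a : cochain (cplx g) p) (b : cochain (cplx g) q)
    (x : {ffun 'I_(p + q) -> cplx g}) :
  form10 I a -> form01 I b ->
  hodge_comp I p' (wedge a b) x = if p' == p then wedge a b x else 0.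
Proof.
move=> aF bF; rewrite /hodge_comp /wedge -mulr_sumr exchange_big /=.
rewrite -[RHS]/(if p' == p then _ else 0).
have -> : (if p' == p then (p`! * q`!)%:R^-1 * \sum_(s : 'S_(p + q)) (-1) ^+ s *
      (a (pull x (s \o lshift q)) * b (pull x (s \o @rshift p q))) else 0) =
   (p`! * q`!)%:R^-1 * \sum_(s : 'S_(p + q)) if p' == p then (-1) ^+ s *
      (a (pull x (s \o lshift q)) * b (pull x (s \o @rshift p q))) else 0.
  by case: (p' == p) => //; rewrite big1 ?mulr0.
congr (_ * _); apply: eq_bigr => s _.
pose T := [set s (lshift q i) | i : 'I_p].
have cardT : #|T| = p.
  by rewrite card_imset ?card_ord //; apply: inj_comp (@perm_inj _ s) (@lshift_inj _ _).
have offT (S : {set 'I_(p + q)}) : S != T ->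
    let X := [ffun i => if i \in S then pr10 I (x i) else pr01 I (x i)] in
    a (pull X (s \o lshift q)) * b (pull X (s \o @rshift p q)) = 0.
  move=> ST X.
  have [/existsP[i iS]|/existsPn noi] := boolP [exists i, s (lshift q i) \notin S].
    by rewrite (aF.2 _ i) ?mul0r // !ffunE /= (negbTE iS) pr01P.
  have [/existsP[j jS]|/existsPn noj] := boolP [exists j, s (@rshift p q j) \in S].
    by rewrite (bF.2 _ j) ?mulr0 // !ffunE /= jS pr10P.
  case/eqP: ST; apply/setP=> m; rewrite -(permKV s m); move: (s^-1%g m) => {}m.
  rewrite -(splitK m); case: (split m) => [i|j] /=.
    by rewrite [RHS]imset_f //; apply/negPn; apply: noi.
  rewrite (negbTE (noj j)); apply/esym/imsetP=> - [i _ /perm_inj/eqP].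
  by rewrite eq_rlshift.
case: (p' =P p) => [->|/eqP pp'].
  rewrite (bigD1 T) ?cardT //= big1 ?addr0 => [|S /andP[_ ST]]; last first.
    by rewrite offT ?mulr0.
  congr (_ * (_ * _)).
    rewrite -(form10_pr10 (pull x _) aF); congr a; apply/ffunP=> i; rewrite !ffunE /=.
    by rewrite imset_f.
  rewrite -(form01_pr01 (pull x _) bF); congr b; apply/ffunP=> j; rewrite !ffunE /=.
  case: imsetP => // - [i _ /perm_inj/eqP]; by rewrite eq_rlshift.
rewrite big1 // => S /eqP Sp; rewrite offT ?mulr0 //.
by apply: contraNneq pp' => ST; rewrite -Sp ST cardT.
Qed.

Lemma hodge_compP p q p' (w : cochain (cplx g) (p + q)) x : hodge_form I w ->
  hodge_comp I p' w x = if p' == p then w x else 0.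
Proof.
case=> n [a [b [aF bF wE]]]; rewrite /hodge_comp (eq_bigr _ (fun _ _ => wE _)) wE.
rewrite exchange_big /= (eq_bigr _ (fun i _ => hodge_comp_wedge p' x (aF i) (bF i))).
by case: (p' == p) => //; rewrite big1.
Qed.

End Hodge.

(* Main.v *)
Require Import Defs.
From HB Require Import structures.
From mathcomp Require Import all_boot all_order all_fingroup all_algebra.
From mathcomp Require Import boolp reals complex ring lra.
Import GRing.Theory Num.Theory.
Local Open Scope ring_scope.
Set Implicit Arguments. Unset Strict Implicit. Unset Printing Implicit Defensive.

(** The (0,q)-forms are the q-forms on the complex Lie algebra [g01], and on
    them the twisted operator is d - alpha /\ _, where d is the
    Chevalley-Eilenberg differential of [g01] and alpha is the restriction of
    theta to [g01].  Since theta is real and non-zero, alpha is non-zero: on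
    the vector x + i I x of [g01], its real part is theta x.  Since theta is
    closed, alpha kills brackets.  The statement thus becomes Dixmier's
    theorem: the cohomology of a nilpotent Lie algebra with values in a
    non-trivial character is zero.

    For that theorem, let y be such that alpha y <> 0, let i_y be the
    contraction by y and L_y the Lie derivative.  The Cartan formula, twisted
    by alpha, reads
<<
      i_y d_alpha + d_alpha i_y = L_y - alpha y
>>
    ([contr_tw_diff]), and L_y commutes with d_alpha ([lie_deriv_tw_diff]).
    On a closed form w the formula gives alpha y * w = L_y w - d_alpha (i_y w),
    so that w is exact as soon as the closed form L_y w is.  By iteration it
    is enough that some power of L_y kills w, which holds because ad y is
    nilpotent ([lie_deriv_nilpotent]); [tw_diff_acyclic] is the outcome.

    Instead of passing to forms on the subspace [g01], the proof keeps the whole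
    complexification and replaces the bracket by
    [bracket01] (u, v) = [pr01 u, pr01 v], for which it is the direct product
    of [g01] and the abelian ideal [g10].  Then the (0,q)-forms are the forms
    that vanish as soon as one argument lies in the ideal [g10]
    ([form_off]), and [twisted_dolbeault_barE] identifies the operator.

    The identities [L_y, L_x] = L_[y, x], L_y d_alpha = d_alpha L_y and
    d_alpha d_alpha = 0 follow by induction on the degree: a form is determined
    by its contractions ([cochain_eq_contr]), and contracting such an identity
    gives the same identity for the contracted form, of lower degree. *)

(** * Exterior forms and contractions *)

Section Forms.
Variables (K : numFieldType) (V : lmodType K).
Implicit Types (k l : nat) (y u v : V).

Lemma cochain_eq_contr k (w w' : cochain V k.+1) :
  (forall y, contr y w = contr y w') -> w = w'.
Proof.
move=> eq_w; apply/funext => x; rewrite (vconsP x).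
exact: (congr1 (fun f => f _) (eq_w (x ord0))).
Qed.

Lemma form_comb k (w w' : cochain V k) (c : K) :
  is_form w -> is_form w' -> is_form (fun z => w z + c * w' z).
Proof.
move=> wF wF'; split=> [x i a u v|x i j ij xij].
  by rewrite wF.1 wF'.1; ring.
by rewrite (wF.2 _ _ _ ij xij) (wF'.2 _ _ _ ij xij) mulr0 addr0.
Qed.

Lemma form0 k : is_form ((fun=> 0) : cochain V k).
Proof. by split=> // x i a u v; rewrite mulr0 addr0. Qed.

Lemma form_deg0 (w : cochain V 0) : is_form w.
Proof. by split=> [x []|x []]. Qed.

Lemma contr_comb k (w : cochain V k.+1) (c : K) u v : is_form w ->
  contr (c *: u + v) w = fun z => c * contr u w z + contr v w z.
Proof.
move=> wF; apply/funext => z.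
by rewrite /contr -(upd_cons0 0) wF.1 !upd_cons0.
Qed.

(** For a repeated argument, the summands of s and of s composed with the
    transposition of the two slots are opposite. *)
Lemma wedge_form k l (a : cochain V k) (b : cochain V l) :
  is_form a -> is_form b -> is_form (wedge a b).
Proof.
move=> aF bF; split=> [x i c u v|x i j ij xij]; rewrite /wedge.
  rewrite [c * _]mulrCA -mulrDr; congr (_ * _); rewrite mulr_sumr -big_split /=.
  apply: eq_bigr => s _; rewrite [c * _]mulrCA -mulrDr; congr (_ * _).
  have [sl sr] : injective (s \o lshift l) /\ injective (s \o @rshift k l).
    split; [exact: inj_comp (@perm_inj _ s) (@lshift_inj _ _)
           |exact: inj_comp (@perm_inj _ s) (@rshift_inj _ _)].
  (* Slot i is fed to a or to b according to the side of its preimage by s. *)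
  rewrite -(permKV s i); move: (s^-1%g i) => m.
  rewrite -(splitK m); case: (split m) => p /=.
    have out t : pull (upd x (s (lshift l p)) t) (s \o @rshift k l) =
      pull x (s \o @rshift k l).
      apply: pull_upd_out => q.
      by rewrite (inj_eq (@perm_inj _ s)) /= eq_rlshift.
    by rewrite !(pull_upd_perm _ (f := s \o lshift l)) // !out aF.1; ring.
  have out t : pull (upd x (s (rshift k p)) t) (s \o lshift l) =
      pull x (s \o lshift l).
    apply: pull_upd_out => q.
    by rewrite (inj_eq (@perm_inj _ s)) /= eq_lrshift.
  by rewrite !(pull_upd_perm _ (f := s \o @rshift k l)) // !out bF.1; ring.
set S := \sum_s _; suff : S = - S.
  by move/eqP; rewrite -addr_eq0 -mulr2n mulrn_eq0 => /eqP ->; rewrite mulr0.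
rewrite {1}/S (reindex_inj (mulIg (tperm i j))) /= -sumrN; apply: eq_bigr => s _.
rewrite odd_permM odd_tperm ij addbT signrN mulNr; congr (- (_ * (a _ * b _))).
  apply/ffunP => p; rewrite !ffunE /= permM.
  by case: tpermP => [->|->|].
apply/ffunP => p; rewrite !ffunE /= permM.
by case: tpermP => [->|->|].
Qed.

End Forms.

(** * Lie derivatives *)

Section LieDerivative.
Variables (K : numFieldType) (V : lmodType K) (br : V -> V -> V).
Hypothesis br_lie : is_lie_bracket br.
Implicit Types (k : nat) (x y : V).

Notation L := (lie_deriv br).

Lemma lie_deriv0 y (w : cochain V 0) : L y w = fun=> 0.
Proof. by apply/funext => z; rewrite /lie_deriv big_ord0 oppr0. Qed.

Lemma lie_deriv_comb k y (w w' : cochain V k) (c : K) :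
  L y (fun z => w z + c * w' z) = fun z => L y w z + c * L y w' z.
Proof.
by apply/funext => z; rewrite /lie_deriv mulrN -opprD mulr_sumr -big_split.
Qed.

Lemma contr_lie_deriv k x y (w : cochain V k.+1) :
  contr x (L y w) = fun z => L y (contr x w) z + -1 * contr (br y x) w z.
Proof.
apply/funext => z; rewrite /contr /lie_deriv big_ord_recl vcons0 upd_cons0.
rewrite opprD addrC mulN1r; congr (- _ - _); apply: eq_bigr => j _.
by rewrite vconsS upd_consS.
Qed.

Lemma lie_antisym x y : br x y = - br y x.
Proof.
have := lie_xx br_lie (x + y).
have := lie_linearl br_lie (x + y) 1 x y; rewrite !scale1r => ->.
have := lie_linearr br_lie x 1 x y; rewrite !scale1r => ->.
have := lie_linearr br_lie y 1 x y; rewrite !scale1r => ->.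
by rewrite !(lie_xx br_lie) add0r addr0 => /eqP; rewrite addr_eq0 => /eqP.
Qed.

Lemma lie0r x : br x 0 = 0.
Proof.
by have := lie_linearr br_lie x (-1) 0 0; rewrite scaler0 addr0 scaleN1r addNr.
Qed.

Lemma lieNr x y : br x (- y) = - br x y.
Proof.
by have := lie_linearr br_lie x (-1) y 0; rewrite !scaleN1r lie0r !addr0.
Qed.

(** By induction on the degree: contracting both sides by u leaves, besides
    the identity for the contracted form, exactly the Jacobi identity for
    y, x and u. *)
Lemma lie_deriv_bracket k x y (w : cochain V k) : is_form w ->
  L (br y x) w = fun z => L y (L x w) z - L x (L y w) z.
Proof.
elim: k w => [|k IH] w wF.
  by rewrite !lie_deriv0; apply/funext => z; rewrite subrr.
apply: cochain_eq_contr => u.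
rewrite contr_lie_deriv IH; last exact: contr_form.
have contr2 a b : contr u (L a (L b w)) = fun z =>
    L a (L b (contr u w)) z - L a (contr (br b u) w) z
    - L b (contr (br a u) w) z + contr (br b (br a u)) w z.
  rewrite !contr_lie_deriv lie_deriv_comb; apply/funext => z.
  by ring.
have -> : contr u (fun z => L y (L x w) z - L x (L y w) z) =
   fun z => contr u (L y (L x w)) z - contr u (L x (L y w)) z by [].
rewrite !contr2; apply/funext => z.
have -> : br (br y x) u = (-1) *: br x (br y u) + br y (br x u).
  rewrite scaleN1r -lieNr -lie_antisym (lie_antisym _ u).
  have /eqP := lie_jacobi br_lie u y x.
  by rewrite -addrA addr_eq0 => /eqP ->; rewrite opprK addrC.
by rewrite contr_comb //; ring.
Qed.

Lemma iter_lie_deriv_form k y (w : cochain V k) n :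
  is_form w -> is_form (iter n (L y) w).
Proof. by move=> wF; elim: n => // n IH; apply: lie_deriv_form. Qed.

(** In degree [k.+1] the [n ^ k.+1] derivatives form n blocks of [n ^ k].
    Since i_x L_y = L_y i_x - i_[y, x], a block either acts entirely on the
    contracted form, which has degree k and is killed by it, or replaces x by
    [y, x]; after n blocks nothing is left.  The exponent is not sharp. *)
Lemma lie_deriv_nilpotent y n : (forall x, iter n (br y) x = 0) ->
  forall k (w : cochain V k), is_form w -> iter (n ^ k) (L y) w = fun=> 0.
Proof.
move=> ad_nil; elim=> [|k IH] w wF; first exact: lie_deriv0.
suff H m x (v : cochain V k.+1) : is_form v -> iter m (br y) x = 0 ->
    contr x (iter (m * n ^ k) (L y) v) = fun=> 0.
  by apply: cochain_eq_contr => x; rewrite expnS H.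
elim: m x v => [|m IHm] x v vF; first move=> /= ->.
  apply/funext => z; rewrite /contr -(upd_cons0 0); exact: form_upd0.
rewrite iterSr => xm; rewrite mulSn iterD.
set v' := iter _ _ v.
have v'F : is_form v' by exact: iter_lie_deriv_form.
have contr_v' j : contr (br y x) (iter j (L y) v') = fun=> 0.
  rewrite -iterD addnC iterD IHm //; exact: iter_lie_deriv_form.
rewrite -(IH (contr x v')); last exact: contr_form.
elim: (n ^ k)%N => //= j IHj.
by rewrite contr_lie_deriv IHj contr_v'; apply/funext => z; rewrite mulr0 addr0.
Qed.

End LieDerivative.

(** * The differential twisted by a character *)

Section TwistedDifferential.
Variables (K : numFieldType) (V : lmodType K) (br : V -> V -> V).
Hypothesis br_lie : is_lie_bracket br.
Variable alpha : V -> K.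
Hypothesis alpha_lin : forall c u v, alpha (c *: u + v) = c * alpha u + alpha v.
Hypothesis alpha_br : forall u v, alpha (br u v) = 0.
Implicit Types (k : nat) (y : V).

Notation L := (lie_deriv br).

Definition tw_diff k (w : cochain V k) : cochain V k.+1 :=
  fun x => ce_diff br w x - wedge (form1 alpha) w x.

Lemma form1_form : is_form (form1 alpha).
Proof.
split=> [x i c u v|x i j]; last by rewrite (ord1 i) (ord1 j) eqxx.
by rewrite /form1 !ffunE (ord1 i) eqxx alpha_lin.
Qed.

Lemma tw_diff_comb k (w w' : cochain V k) (c : K) :
  tw_diff (fun z => w z + c * w' z) = fun z => tw_diff w z + c * tw_diff w' z.
Proof.
by apply/funext => z; rewrite /tw_diff ce_diffD wedgeDr; ring.
Qed.

Lemma tw_diffZ k (w : cochain V k) (c : K) :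
  tw_diff (fun z => c * w z) = fun z => c * tw_diff w z.
Proof.
have -> : (fun z => c * w z) = fun z => w z + (c - 1) * w z.
  by apply/funext => z; ring.
by rewrite tw_diff_comb; apply/funext => z; ring.
Qed.

Lemma tw_diff0 k : tw_diff ((fun=> 0) : cochain V k) = fun=> 0.
Proof.
transitivity (tw_diff (fun z : {ffun 'I_k -> V} => 0 * (0 : K))).
  by congr tw_diff; apply/funext => z; rewrite mul0r.
by rewrite tw_diffZ; apply/funext => z; rewrite mul0r.
Qed.

Lemma tw_diff_form k (w : cochain V k) : is_form w -> is_form (tw_diff w).
Proof.
move=> wF; suff -> : tw_diff w =
    fun z => ce_diff br w z + -1 * wedge (form1 alpha) w z.
  apply: form_comb; first exact: ce_diff_form.
  exact: wedge_form form1_form wF.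
by apply/funext => z; rewrite mulN1r.
Qed.

(** The twisted Cartan formula in degree 0, where there is no contraction and
    the Lie derivative is zero. *)
Lemma contr_tw_diff0 (x : V) (w : cochain V 0) :
  contr x (tw_diff w) = fun z => - alpha x * w z.
Proof.
apply/funext => z; rewrite /contr /tw_diff ce_diff0 sub0r.
rewrite (@wedge_0r _ _ _ _ _ (erefl 1%N)) ?mulNr; last exact: form1_form.
rewrite /form1 ffunE (_ : cast_ord _ _ = ord0) ?vcons0; last exact: val_inj.
by congr (- (_ * w _)); apply/ffunP => - [].
Qed.

(** The twisted Cartan formula: wedging with alpha adds only the scalar
    [- alpha x], because contraction is an antiderivation. *)
Lemma contr_tw_diff k (x : V) (w : cochain V k.+1) : is_form w ->
  contr x (tw_diff w) =
    fun z => L x w z + - alpha x * w z + -1 * tw_diff (contr x w) z.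
Proof.
move=> wF; apply/funext => z.
rewrite -[LHS]/(contr x (ce_diff br w) z - contr x (wedge (form1 alpha) w) z).
rewrite cartan (@contr_wedge _ _ 0 k _ _ x (erefl k.+1) z form1_form wF).
rewrite wedge_0l //.
rewrite [pull z _]pull_id; last by move=> i; apply: val_inj.
by rewrite /contr /form1 vcons0 /tw_diff; ring.
Qed.

(** Contracting by x turns [L_y, d_alpha] into [L_y, L_x] - L_[y, x], which
    is zero, and the commutator on the contracted form; the twist by alpha
    disappears because [alpha (br y x) = 0]. *)
Lemma lie_deriv_tw_diff k y (w : cochain V k) : is_form w ->
  L y (tw_diff w) = tw_diff (L y w).
Proof.
elim: k w => [|k IH] w wF; apply: cochain_eq_contr => x; rewrite contr_lie_deriv.
  rewrite !contr_tw_diff0 alpha_br !lie_deriv0.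
  by apply/funext => z; ring.
have LF := lie_deriv_form br_lie y wF.
rewrite !contr_tw_diff // alpha_br lie_deriv_comb lie_deriv_comb.
rewrite contr_lie_deriv tw_diff_comb IH; last exact: contr_form.
by apply/funext => z; rewrite (lie_deriv_bracket br_lie) //; ring.
Qed.

(** Contracting by x, the Cartan formula leaves [L_x, d_alpha] = 0 and the
    square of d_alpha on the contracted form. *)
Lemma tw_diff_sq k (w : cochain V k) : is_form w ->
  tw_diff (tw_diff w) = fun=> 0.
Proof.
elim: k w => [|k IH] w wF; apply: cochain_eq_contr => x.
  rewrite contr_tw_diff; last exact: tw_diff_form.
  rewrite lie_deriv_tw_diff // lie_deriv0 contr_tw_diff0 tw_diff0 tw_diffZ.
  by apply/funext => z; rewrite [RHS]/contr; ring.
rewrite contr_tw_diff; last exact: tw_diff_form.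
rewrite lie_deriv_tw_diff // contr_tw_diff // !tw_diff_comb.
rewrite IH; last exact: contr_form.
by apply/funext => z; rewrite [RHS]/contr; ring.
Qed.

Section Acyclicity.
Variable A : {pred V}.
Hypothesis A_ideal : forall a u, a \in A -> br u a \in A /\ br a u \in A.
Hypothesis alpha_A : forall a, a \in A -> alpha a = 0.

(** For an ideal [A], these are the forms lifted from the quotient by [A].
    With [A := g10 I] this is convertible to [form01 I]. *)
Definition form_off k (w : cochain V k) :=
  is_form w /\ forall (x : {ffun 'I_k -> V}) i, x i \in A -> w x = 0.

Lemma form_off_comb k (w w' : cochain V k) (c : K) :
  form_off w -> form_off w' -> form_off (fun z => w z + c * w' z).
Proof.
move=> [wF wA] [wF' wA']; split; first exact: form_comb.
by move=> x i xi; rewrite (wA x i xi) (wA' x i xi) mulr0 addr0.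
Qed.

Lemma form_offZ k (w : cochain V k) (c : K) :
  form_off w -> form_off (fun z => c * w z).
Proof.
move=> wA; have -> : (fun z => c * w z) = fun z => w z + (c - 1) * w z.
  by apply/funext => z; ring.
exact: form_off_comb.
Qed.

Lemma form_off_contr k (w : cochain V k.+1) (x : V) :
  form_off w -> form_off (contr x w).
Proof.
move=> [wF wA]; split; first exact: contr_form.
by move=> z i zi; apply: (wA _ (lift ord0 i)); rewrite vconsS.
Qed.

Lemma form_off_lie_deriv k y (w : cochain V k) : form_off w -> form_off (L y w).
Proof.
move=> [wF wA]; split; first exact: lie_deriv_form.
move=> x i xi; rewrite /lie_deriv big1 ?oppr0 // => j _.
apply: (wA _ i); rewrite ffunE; case: eqP => [<-|//].
exact: (A_ideal _ _).1.
Qed.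

(** An element a of the ideal can be moved to the first slot, where the Cartan
    formula expresses the contraction of d_alpha w through i_a w, L_a w and
    alpha a, which are all zero. *)
Lemma form_off_tw_diff k (w : cochain V k) : form_off w -> form_off (tw_diff w).
Proof.
move=> [wF wA]; have dwF := tw_diff_form wF.
split=> // x i; rewrite (form_insert _ i dwF).
move: (x i) (pull x _) => a z aA; rewrite -[tw_diff w _]/(contr a (tw_diff w) z).
suff -> : contr a (tw_diff w) = fun=> 0 by rewrite mulr0.
case: k w wF wA {x i dwF z} => [|k] w wF wA.
  by rewrite contr_tw_diff0 alpha_A //; apply/funext => t; rewrite oppr0 mul0r.
rewrite contr_tw_diff // alpha_A //.
have -> : contr a w = fun=> 0.
  by apply/funext => t; rewrite /contr (wA _ ord0) ?vcons0.
rewrite tw_diff0; apply/funext => t.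
rewrite /lie_deriv big1 => [|j _]; first by ring.
by rewrite (wA _ j) // ffunE eqxx (A_ideal _ _).2.
Qed.

Variables (y : V) (n : nat).
Hypothesis ad_nil : forall x, iter n (br y) x = 0.
Hypothesis alpha_y : alpha y != 0.

Lemma tw_diff_closed_deg0 (w : cochain V 0) : tw_diff w = (fun=> 0) -> w = fun=> 0.
Proof.
move=> dw; apply/funext => z; have := contr_tw_diff0 y w; rewrite dw.
move/(congr1 (fun f => f z)) => /esym/eqP.
by rewrite mulf_eq0 oppr_eq0 (negbTE alpha_y) => /eqP.
Qed.

(** Induction on the number N of Lie derivatives that kill w: the closed form
    L_y w is d_alpha eta by induction, whence the primitive
    (eta - i_y w) / alpha y of w. *)
Lemma tw_diff_acyclic k (w : cochain V k.+1) : form_off w ->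
  tw_diff w = (fun=> 0) -> exists2 eta, form_off eta & w = tw_diff eta.
Proof.
move=> wA dw; have := lie_deriv_nilpotent br_lie ad_nil wA.1.
elim: (n ^ _)%N w wA dw => [|N IH] w wA dw.
  move=> /= w0.
  have zA : form_off ((fun=> 0) : cochain V k) by split=> //; exact: form0.
  by exists (fun=> 0); rewrite ?w0 ?tw_diff0.
rewrite iterSr => LNw.
have dLw : tw_diff (L y w) = fun=> 0.
  rewrite -lie_deriv_tw_diff ?dw; last exact: wA.1.
  by apply/funext => z; rewrite /lie_deriv big1 ?oppr0.
have [eta etaA Lw] := IH _ (form_off_lie_deriv y wA) dLw LNw.
exists (fun z => (alpha y)^-1 * (eta z + -1 * contr y w z)).
  by apply/form_offZ/form_off_comb => //; exact: form_off_contr.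
rewrite tw_diffZ tw_diff_comb -Lw; apply/funext => z.
have := contr_tw_diff y wA.1; rewrite dw => /(congr1 (fun f => f z)).
rewrite [LHS]/contr => /esym/eqP.
rewrite addrAC addr_eq0 -mulNr opprK => /eqP ->.
by rewrite mulKf.
Qed.

End Acyclicity.
End TwistedDifferential.

(** * The complexified Lie algebra and its (0,1)-part *)

(** Reduces an identity between vectors to one between scalars, which [ring]
    and [lra] decide. *)
Lemma vect_eqP (R : fieldType) (W : vectType R) (u v : W) :
  (forall f : W -> R, (forall x y, f (x + y) = f x + f y) ->
     (forall x, f (- x) = - f x) -> (forall a x, f (a *: x) = a * f x) ->
     f u = f v) -> u = v.
Proof.
move=> eq_f; rewrite (coord_vbasis (memvf u)) (coord_vbasis (memvf v)).
apply: eq_bigr => i _; congr (_ *: _).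
by apply: eq_f => [x y|x|a x]; rewrite ?linearD ?linearN ?linearZ.
Qed.

Section AntiHolomorphicBracket.
Variables (R : realType) (g : vectType R) (br : g -> g -> g).
Variable I : {linear g -> g}.
Hypothesis br_lie : is_lie_bracket br.
Hypothesis I_sq : forall x, I (I x) = - x.
Hypothesis g10_sub : forall z w, z \in g10 I -> w \in g10 I ->
  cplx_bracket br z w \in g10 I.
Implicit Types (x y : g) (u v z : cplx g) (c : R[i]).

Lemma lieDl x y t : br (x + y) t = br x t + br y t.
Proof. by have := lie_linearl br_lie t 1 x y; rewrite !scale1r. Qed.

Lemma lieDr x y t : br t (x + y) = br t x + br t y.
Proof. by have := lie_linearr br_lie t 1 x y; rewrite !scale1r. Qed.

Let lieC x y : br x y = - br y x.
Proof. exact: lie_antisym. Qed.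

Let lieNr' x y : br x (- y) = - br x y.
Proof. exact: lieNr. Qed.

Lemma lieNl x y : br (- x) y = - br x y.
Proof. by rewrite lieC lieNr' -lieC. Qed.

Lemma lieZr (a : R) x y : br x (a *: y) = a *: br x y.
Proof.
have := lie_linearr br_lie x a y 0; rewrite addr0 => ->.
by rewrite -[in br x 0](subrr y) lieDr lieNr' subrr addr0.
Qed.

Lemma lieZl (a : R) x y : br (a *: x) y = a *: br x y.
Proof. by rewrite lieC lieZr (lieC y) scalerN opprK. Qed.

Definition lieE := (lieDl, lieDr, lieNl, lieNr', lieZl, lieZr).

(** The Jacobi identity expands, in the real and in the imaginary part, into
    four real Jacobi identities. *)
Lemma cplx_bracket_lie :
  is_lie_bracket (cplx_bracket br : cplx g -> cplx g -> cplx g).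
Proof.
split=> [y [a b] u v|x [a b] u v|x|x y z]; congr (_, _) => /=; rewrite ?lieE.
1-4: by apply: vect_eqP => f fD fN fZ; rewrite !(fD, fN, fZ); ring.
- by rewrite !(lie_xx br_lie) subrr.
- by rewrite [br x.2 _]lieC subrr.
all: apply: vect_eqP => f fD fN fZ.
all: have f0 : f 0 = 0 by rewrite -[0](subrr 0) fD fN subrr.
all: have J p q r := congr1 f (lie_jacobi br_lie p q r).
- have := (J x.1 y.1 z.1, J x.1 y.2 z.2, J x.2 y.1 z.2, J x.2 y.2 z.1).
  by rewrite !(fD, fN) f0 => - [[[J1 J2] J3] J4]; lra.
have := (J x.1 y.1 z.2, J x.1 y.2 z.1, J x.2 y.1 z.1, J x.2 y.2 z.2).
by rewrite !(fD, fN) f0 => - [[[J1 J2] J3] J4]; lra.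
Qed.

Lemma g10E z : (z \in g10 I) = (z.2 == - I z.1).
Proof.
rewrite inE; case: z => x y; rewrite /cplx_map /=; apply/eqP/eqP.
  by case; rewrite !(scale0r, scale1r) sub0r => ->; rewrite opprK.
move=> ->; congr (_, _); rewrite /= !(scale0r, scale1r) ?sub0r ?opprK //.
by rewrite linearN I_sq opprK add0r.
Qed.

Lemma g01E z : (z \in g01 I) = (z.2 == I z.1).
Proof.
rewrite inE; case: z => x y; rewrite /cplx_map /=; apply/eqP/eqP.
  by case; rewrite !(oppr0, scale0r, scaleN1r) sub0r opprK => ->.
by move=> ->; congr (_, _); rewrite /= !(oppr0, scale0r, scaleN1r) ?sub0r ?opprK.
Qed.

(** Complex conjugation exchanges [g10] and [g01] and respects the bracket. *)
Lemma g01_sub u v : u \in g01 I -> v \in g01 I -> cplx_bracket br u v \in g01 I.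
Proof.
case: u v => [x x'] [y y']; rewrite !g01E /= => /eqP -> /eqP ->.
have := @g10_sub (x, - I x) (y, - I y); rewrite !g10E /= !eqxx => /(_ isT isT).
rewrite !lieE opprK -opprD eqr_opp; exact.
Qed.

Lemma pr01_lin c u v : pr01 I (c *: u + v) = c *: pr01 I u + pr01 I v.
Proof.
rewrite /pr01 cplx_mapD cplx_mapZ [c *: (_ *: _)]scalerA [c * _]mulrC -scalerA.
rewrite -scalerDr; congr (_ *: _).
by rewrite !scalerDr !scalerA [c * _]mulrC addrACA.
Qed.

Lemma pr01_id z : z \in g01 I -> pr01 I z = z.
Proof.
rewrite inE => /eqP zE; rewrite -[RHS](pr10D01 I) /pr10 zE.
have -> : 'i%C *: (- 'i%C *: z) = z.
  by apply: (etrans (scalerA _ _ _)); rewrite mulrN icplx_sq opprK scale1r.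
by rewrite subrr scaler0 add0r.
Qed.

Lemma pr01_g10 z : z \in g10 I -> pr01 I z = 0.
Proof.
rewrite inE /pr01 => /eqP ->.
have -> : 'i%C *: ('i%C *: z) = - z.
  by apply: (etrans (scalerA _ _ _)); rewrite icplx_sq scaleN1r.
by rewrite subrr scaler0.
Qed.

(** The bracket of the direct product of [g01] and the abelian algebra on the
    space [g10]. *)
Definition bracket01 u v : cplx g := cplx_bracket br (pr01 I u) (pr01 I v).

Lemma bracket01_in_g01 u v : bracket01 u v \in g01 I.
Proof. by apply: g01_sub; apply: pr01P. Qed.

Lemma bracket01_lie : is_lie_bracket bracket01.
Proof.
have L := cplx_bracket_lie.
split=> [y c u v|x c u v|x|x y z]; rewrite /bracket01.
- by rewrite pr01_lin (lie_linearl L).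
- by rewrite pr01_lin (lie_linearr L).
- exact: lie_xx.
- by rewrite ![pr01 I (cplx_bracket _ _ _)]pr01_id ?bracket01_in_g01 // (lie_jacobi L).
Qed.

(** Once inside [g01], where [pr01] is the identity, bracketing is done by the
    complexified bracket, which moves both real components down the lower
    central series.  The extra step of the exponent brings u into [g01]:
    [pr01] involves I, which need not preserve the lower central series. *)
Lemma bracket01_nilpotent v : nilpotent_lie br ->
  exists n, forall u, iter n (bracket01 v) u = 0.
Proof.
case=> n lc0; exists n.+1 => u; rewrite iterSr.
move: (bracket01 v u) (bracket01_in_g01 v u) => {}u uP.
suff [u1 u2 _] : [/\ (iter n (bracket01 v) u).1 \in lower_central br n,
    (iter n (bracket01 v) u).2 \in lower_central br n & iter n (bracket01 v) u \in g01 I].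
  move: u1 u2; rewrite lc0 !memv0; case: (iter _ _ _) => x y /= /eqP -> /eqP ->.
  by [].
elim: n {lc0} => [|n [IH1 IH2 IH3]]; first by rewrite /= !memvf.
have sub x y : y \in lower_central br n -> br x y \in lower_central br n.+1.
  move=> yn; have := (lie_prodP br_lie fullv (lower_central br n) _).1 (subvv _).
  by apply; rewrite ?memvf.
rewrite iterS; split; last exact: bracket01_in_g01.
  by rewrite /bracket01 (pr01_id IH3) /= rpredB ?sub.
by rewrite /bracket01 (pr01_id IH3) /= rpredD ?sub.
Qed.

End AntiHolomorphicBracket.

(** * The twisted Dolbeault operator on (0,q)-forms *)

Section TwistedDolbeault.
Variables (R : realType) (g : vectType R) (br : g -> g -> g).
Variables (I : {linear g -> g}) (theta : 'Hom(g, R^o)).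
Hypothesis br_lie : is_lie_bracket br.
Hypothesis I_sq : forall x, I (I x) = - x.
Hypothesis g10_sub : forall z w, z \in g10 I -> w \in g10 I ->
  cplx_bracket br z w \in g10 I.
Hypothesis theta_closed : ce_diff br (form1 theta) =1 fun=> 0.

Let V := cplx g.

Definition theta_pr01 (z : V) : R[i] := cplx_covector theta (pr01 I z).

Lemma theta_pr01_lin c (u v : V) :
  theta_pr01 (c *: u + v) = c * theta_pr01 u + theta_pr01 v.
Proof.
rewrite /theta_pr01 pr01_lin; move: (pr01 I u) (pr01 I v) => [x x'] [y y'].
case: c => [a b]; rewrite /cplx_covector /=; apply/eqP; rewrite eq_complex /=.
rewrite !(linearD, linearN, linearZ).
by apply/andP; split; apply/eqP.
Qed.

Lemma theta_bracket (x y : g) : theta (br x y) = 0.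
Proof.
have := theta_closed (vcons x (vcons y [ffun=> 0])).
rewrite ce_diff_form1 vcons0 (_ : ord_max = lift ord0 ord0); last exact: val_inj.
by rewrite vconsS vcons0 => /eqP; rewrite oppr_eq0 => /eqP.
Qed.

Lemma theta_pr01_bracket01 (u v : V) : theta_pr01 (bracket01 br I u v) = 0.
Proof.
rewrite /theta_pr01 pr01_id ?bracket01_in_g01 //.
rewrite /bracket01 /cplx_covector; move: (pr01 I u) (pr01 I v) => [x x'] [y y'] /=.
by rewrite linearB linearD /= !theta_bracket subrr addr0.
Qed.

Lemma theta_pr01_neq0 : theta != 0 -> exists y : V, theta_pr01 y != 0.
Proof.
move=> theta_neq0; have [x thx] : exists x, theta x != 0.
  apply: contrapT => /forallNP theta0; case/eqP: theta_neq0.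
  by apply/lfunP => x; rewrite lfunE /=; apply/eqP/negPn/negP/theta0.
exists (x, I x); rewrite /theta_pr01 pr01_id ?g01E //.
by rewrite /cplx_covector eq_complex /= negb_and thx.
Qed.

Lemma theta01E : theta01 I theta = form1 theta_pr01.
Proof.
apply/funext => x; rewrite /theta01 /hodge_comp (big_pred1 set0) => [|S].
  by rewrite /form1 ffunE inE.
by rewrite cards_eq0.
Qed.

(** The (0,0)-factors are constants, so a sum of wedges is a linear
    combination of (0,q)-forms. *)
Lemma hodge_form0P q (w : cochain V q) :
  hodge_form I (p := 0) w <-> form01 I w.
Proof.
split=> [[n [a [b [aF bF wE]]]]|wF]; last first.
  exists 1%N, (fun=> fun=> 1), (fun=> w); split=> // [_|x].
    by split; [exact: form_deg0|move=> x []].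
  by rewrite big_ord1 wedge_0l ?mul1r //; exact: wF.1.
pose c i := a i [ffun=> 0].
have -> : w = fun x => \sum_(i < n) c i * b i x.
  apply/funext => x; rewrite wE; apply: eq_bigr => i _.
  by rewrite wedge_0l //; exact: (bF i).1.
split; last first.
  by move=> x i xi; rewrite big1 // => j _; rewrite ((bF j).2 _ _ xi) mulr0.
split=> [x i d u v|x i j ij xij].
  rewrite mulr_sumr -big_split; apply: eq_bigr => j _.
  by rewrite (bF j).1.1 /=; ring.
by rewrite big1 // => m _; rewrite ((bF m).1.2 _ _ _ ij xij) mulr0.
Qed.

(** Only the bidegree (0,q) of w contributes, and the (0,q+1)-component of its
    differential is read off on projected vectors; the bracket of two of them
    is [bracket01]. *)
Lemma twisted_dolbeault_barE q (w : cochain V q) : form01 I w ->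
  twisted_dolbeault_bar I br theta w = tw_diff (bracket01 br I) theta_pr01 w.
Proof.
move=> wF; have wH := (hodge_form0P w).2 wF.
apply/funext => x; rewrite /twisted_dolbeault_bar /tw_diff theta01E.
congr (_ - _); rewrite /dolbeault_bar big_ord_recl big1 => [|p _]; last first.
  rewrite /hodge_comp big1 // => S _; rewrite /ce_diff.
  rewrite big1 // => i _; rewrite big1 // => j _.
  have := hodge_compP I_sq (p := 0) (lift ord0 p) _ wH.
  by rewrite {1}/hodge_comp => ->; rewrite mulr0.
rewrite addr0 {1}/hodge_comp (big_pred1 set0) => [|S]; last by rewrite cards_eq0.
rewrite /ce_diff; apply: eq_bigr => i _; apply: eq_bigr => j _; congr (_ * _).
rewrite (hodge_compP I_sq (p := 0) 0 _ wH) eqxx.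
(* w only sees (0,1)-parts, so its remaining arguments may be projected too. *)
rewrite -[LHS](form01_pr01 I_sq _ wF) -[RHS](form01_pr01 I_sq _ wF).
congr w; apply/ffunP => m.
rewrite !ffunE !inE; case: eqP => // _.
by rewrite pr01_id ?pr01P.
Qed.

Lemma bracket01_ideal (a u : V) : a \in g10 I ->
  bracket01 br I u a \in g10 I /\ bracket01 br I a u \in g10 I.
Proof.
move=> aP; have L := cplx_bracket_lie br_lie.
have zP : (0 : V) \in g10 I by rewrite g10E //= linear0 oppr0.
rewrite /bracket01 (pr01_g10 aP) (lie_antisym L 0) (lie0r L) oppr0; by split.
Qed.

End TwistedDolbeault.

Theorem theorem1p1 (R : realType) (g : vectType R) (br : g -> g -> g)
    (I : {linear g -> g}) (theta : 'Hom(g, R^o))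
    (br_lie : is_lie_bracket br) (br_nil : nilpotent_lie br)
    (I_sq : forall x, I (I x) = - x)
    (g10_sub : forall z w, z \in g10 I -> w \in g10 I ->
                 cplx_bracket br z w \in g10 I)
    (theta_neq0 : theta != 0)
    (theta_closed : ce_diff br (form1 theta) =1 fun=> 0)
    (q : nat) (w : cochain (cplx g) q) :
  twisted_dolbeault_kernel I br theta w <-> twisted_dolbeault_image I br theta w.
Proof.
have lie01 := bracket01_lie br_lie I_sq g10_sub.
have lin := theta_pr01_lin I theta.
have closed := theta_pr01_bracket01 br_lie I_sq g10_sub theta_closed.
have ideal := bracket01_ideal br_lie I_sq.
have alpha_g10 a : a \in g10 I -> theta_pr01 I theta a = 0.
  by move=> aP; rewrite /theta_pr01 (pr01_g10 aP) /cplx_covector /= linear0.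
have [y y_neq0] := theta_pr01_neq0 I_sq theta_neq0.
have [n ad_nil] := bracket01_nilpotent br_lie I_sq g10_sub y br_nil.
have barE q' (v : cochain (cplx g) q') :=
  @twisted_dolbeault_barE _ _ br I theta I_sq q' v.
split.
  case=> /hodge_form0P wF /funext; rewrite barE // => dw.
  case: q w wF dw => [|q] w wF dw /=.
    by rewrite (tw_diff_closed_deg0 lin y_neq0 dw).
  have [eta etaF ->] := tw_diff_acyclic lie01 lin closed ideal ad_nil y_neq0 wF dw.
  by exists eta; [exact/hodge_form0P|rewrite barE].
case: q w => [|q] w.
  move=> /funext /= ->; have F0 : form01 I ((fun=> 0) : cochain (cplx g) 0).
    by split=> //; exact: form_deg0.
  by split; [exact/hodge_form0P|rewrite barE // tw_diff0].
move=> [eta /hodge_form0P etaF /funext ->]; rewrite barE //.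
have dF := form_off_tw_diff lie01 lin ideal alpha_g10 etaF.
split; first exact/hodge_form0P.
by rewrite barE // tw_diff_sq //; exact: etaF.1.
Qed.
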